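(* Let $\pi$ be a non-empty set of primes. A relatively free nilpotent $\pi$-torsion-free group $G$ and its $\pi$-completion $\widehat{G}^\pi$ define the same quasi-variety.
   Context: A $\pi$-number is an integer that is a product of powers of primes from $\pi$. A group $G$ is $\pi$-torsion-free if for every $\pi$-number $n$ the equation $x^n=1$ has only the trivial solution in $G$; it is $\pi$-divisible if for every $\pi$-number $n$ and every $a\in G$ the equation $x^n=a$ has a solution in $G$; it is $\pi$-complete if it is both $\pi$-divisible and $\pi$-torsion-free. A relatively free group is a free group of some variety of groups, i.e. a group isomorphic to $F/V$ with $F$ a free group and $V$ a verbal subgroup of $F$. A relatively free nilpotent $\pi$-torsion-free group is a relatively free group that is nilpotent and $\pi$-torsion-free; such groups arise as $F_n/H$, where $F_n$ is a relatively free $n$-step nilpotent group and $H$ is a verbal subgroup of $F_n$ that is $\pi$-isolated (i.e. $g\in F_n$ and $g^k\in H$ for some $\pi$-number $k$ imply $g\in H$). The $\pi$-completion $\widehat{G}^\pi$ of a $\pi$-torsion-free nilpotent group $G$ is the minimal $\pi$-complete nilpotent group containing $G$. It exists, is unique up to isomorphism, and is characterized as a $\pi$-complete nilpotent group containing $G$ in which every element $g$ satisfies $g^m\in G$ for some $\pi$-number $m$. It is regarded as an abstract group (only the usual group operations). Two groups define (generate) the same quasi-variety if they satisfy the same quasi-identities, where a quasi-identity is a sentence $\forall x_1\cdots\forall x_n\,\bigl(w_1=1\wedge\dots\wedge w_k=1\Rightarrow w=1\bigr)$ with $w_1,\dots,w_k,w$ group words in $x_1,\dots,x_n$. *)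

(* Defs.v *)
From HB Require Import structures.
From mathcomp Require Import all_boot.
From mathcomp Require Import boolp classical_sets functions.

Set Implicit Arguments.
Unset Strict Implicit.
Unset Printing Implicit Defensive.

Local Open Scope classical_set_scope.
Local Open Scope group_scope.

Section Subgroups.
Variable G : groupType.
Implicit Types (A B S : set G) (pi : nat_pred).

Definition is_subgroup A : Prop :=
  [/\ A 1, (forall x y, A x -> A y -> A (x * y)) & forall x, A x -> A x^-1].

Definition generated S : set G := smallest is_subgroup S.

Definition commutators A B : set G :=
  [set z | exists x y, [/\ A x, B y & z = [~ x, y]]].

(* Indexed from 0: the n-th term is the usual gamma_(n+1)(A). *)
Fixpoint lower_central A (n : nat) : set G :=
  if n is m.+1 then generated (commutators (lower_central A m) A) else A.

Definition is_nilpotent A : Prop := exists n, lower_central A n `<=` [set 1].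

Definition pi_torsion_free pi A : Prop :=
  forall n x, pi.-nat n -> A x -> x ^+ n = 1 -> x = 1.

Definition pi_divisible pi A : Prop :=
  forall n a, pi.-nat n -> A a -> exists2 x, A x & x ^+ n = a.

Definition pi_complete pi A : Prop := pi_divisible pi A /\ pi_torsion_free pi A.

End Subgroups.

Inductive word (X : Type) : Type :=
  | WVar of X
  | WOne
  | WMul of word X & word X
  | WInv of word X.
Arguments WOne {X}.

Fixpoint eval (X : Type) (G : groupType) (v : X -> G) (w : word X) : G :=
  match w with
  | WVar x => v x
  | WOne => 1
  | WMul w1 w2 => eval v w1 * eval v w2
  | WInv w1 => (eval v w1)^-1
  end.

Definition verbal_subgroup (G : groupType) (W : set (word nat)) : set G :=
  generated [set g | exists w v, W w /\ g = eval v w].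

Definition is_verbal (G : groupType) (V : set G) : Prop :=
  exists W, V = verbal_subgroup W.

Definition is_basis (F : groupType) (X : Type) (b : X -> F) : Prop :=
  forall (H : groupType) (f : X -> H),
    exists! h : F -> H, monoid_morphism h /\ forall x, h (b x) = f x.

Definition is_free (F : groupType) : Prop :=
  exists (X : Type) (b : X -> F), is_basis b.

(* By the first isomorphism theorem, G is isomorphic to F / V exactly when V is
   the kernel of a surjective morphism from F to G. *)
Definition relatively_free (G : groupType) : Prop :=
  exists (F : groupType) (phi : F -> G),
    [/\ is_free F, monoid_morphism phi, range phi = setT
      & is_verbal (phi @^-1` [set 1])].

(* Minimality: no proper subgroup of H containing the copy of G inside H is
   again pi-complete and nilpotent. *)
Definition is_pi_completion (pi : nat_pred) (G H : groupType) (iota : G -> H)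
    : Prop :=
  [/\ monoid_morphism iota, injective iota,
      pi_complete pi [set: H], is_nilpotent [set: H]
    & forall A : set H, is_subgroup A -> pi_complete pi A -> is_nilpotent A ->
        range iota `<=` A -> A = [set: H]].

(* forall x_1 ... x_n, w_1 = 1 /\ ... /\ w_k = 1 => w = 1 *)
Record quasi_identity : Type := QuasiIdentity {
  qi_nvars : nat;
  qi_npremises : nat;
  qi_premise : 'I_qi_npremises -> word 'I_qi_nvars;
  qi_conclusion : word 'I_qi_nvars
}.

Definition satisfies (G : groupType) (q : quasi_identity) : Prop :=
  forall v : 'I_(qi_nvars q) -> G,
    (forall i, eval v (qi_premise i) = 1) -> eval v (qi_conclusion q) = 1.

Definition same_quasivariety (G H : groupType) : Prop :=
  forall q, satisfies G q <-> satisfies H q.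

(* Main.v *)
(* For a pi-number k, the endomorphism phi of G raising each free generator to the
   k-th power acts on the n-th lower central factor as the k^n-th power. Hence
   phi is injective (G being pi-torsion-free), and phi^c maps every element of G
   to a k-th power when G has class c. If v is a tuple of the completion with
   v_i^k = u_i in G, write phi^c(u_i) = y_i^k with y_i in G. The pairs
   (v_i, y_i) lie in the set R of pi-roots of the graph of phi^c in the product
   of the completion and G; R is a subgroup because that product is nilpotent,
   and, by injectivity and torsion-freeness, (a, b) in R has a = 1 iff b = 1. So
   the tuples v and y satisfy the same equations w = 1. *)
Require Import Defs.
From HB Require Import structures.
From Corelib Require Import Setoid Morphisms.
From mathcomp Require Import all_boot.
From mathcomp Require Import boolp classical_sets functions.

Set Implicit Arguments.
Unset Strict Implicit.
Unset Printing Implicit Defensive.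

Local Open Scope classical_set_scope.
Local Open Scope group_scope.

(** * Subgroups as groups in their own right *)

Section SubgroupType.
Variables (G : groupType) (A : set G).

(** The closure proof is a parameter of the type so that the group structure can be attached to
    it. *)
Definition subgroup_type (A_subgroup : is_subgroup A) : Type :=
  {x : G | x \in A}.

Variable A_subgroup : is_subgroup A.

Lemma subgroup_group_closed : group_closed (mem A).
Proof.
have [A1 AM AV] := A_subgroup.
by split=> [|x y]; rewrite !inE // => Ax Ay; apply/AM/AV.
Qed.

HB.instance Definition _ := SubChoice.on (subgroup_type A_subgroup).
HB.instance Definition _ := SubChoice_isSubGroup.Build G (mem A)
  (subgroup_type A_subgroup) subgroup_group_closed.
End SubgroupType.

(** * The lower central series and calculation modulo its terms *)

Section Congruence.
Variable T : groupType.

Definition lcs n : set T := lower_central [set: T] n.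
(** Equality of left cosets; normality of [lcs n] makes it compatible with the operations, and the
    instances below allow rewriting with it. *)
Definition lcs_eq n x y : Prop := lcs n (x^-1 * y).

Lemma generated_subgroup (S : set T) : is_subgroup (generated S).
Proof.
split=> [A [[]]//|x y Sx Sy A HA|x Sx A HA]; have [[A1 AM AV] _] := HA.
  by apply: AM; [apply: Sx|apply: Sy].
by apply: AV; apply: Sx.
Qed.

Lemma lcs_subgroup n : is_subgroup (lcs n).
Proof. by case: n => [|n]; [split|apply: generated_subgroup]. Qed.

Lemma lcs1 n : lcs n 1. Proof. by case: (lcs_subgroup n). Qed.
Lemma lcsM n x y : lcs n x -> lcs n y -> lcs n (x * y).
Proof. by case: (lcs_subgroup n) => _ + _; apply. Qed.
Lemma lcsV n x : lcs n x -> lcs n x^-1.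
Proof. by case: (lcs_subgroup n) => _ _; apply. Qed.
Lemma lcsX n x k : lcs n x -> lcs n (x ^+ k).
Proof.
by move=> nx; elim: k => [|k IHk]; [apply: lcs1|rewrite expgS; apply: lcsM].
Qed.

Lemma lcsR n x y : lcs n x -> lcs n.+1 [~ x, y].
Proof. by move=> nx; apply: sub_gen_smallest; exists x, y. Qed.

Lemma lcs_ind n (P : set T) : is_subgroup P ->
  (forall x y, lcs n x -> P [~ x, y]) -> lcs n.+1 `<=` P.
Proof.
move=> P_subgroup PR; apply: smallest_sub => // _ [x [y [nx _ ->]]].
exact: PR.
Qed.

(** Since [x ^ y = x * [~ x, y]], an [x] in [lcs n.+1] is no problem once it also lies in [lcs n];
    that inclusion comes from normality of [lcs n], the induction hypothesis. *)
Lemma lcsJ n x y : lcs n x -> lcs n (x ^ y).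
Proof.
elim: n x y => [|n IHn] x y nx; first exact: I.
have sub : lcs n.+1 `<=` lcs n.
  apply: lcs_ind => [|{}x {}y {}nx]; first exact: lcs_subgroup.
  by rewrite commgEl; apply: lcsM; [apply: lcsV|apply: IHn].
rewrite -[x ^ y](mulVKg x) -commgEl; apply: lcsM => //.
by apply: lcsR; apply: sub.
Qed.

Lemma lcsS n : lcs n.+1 `<=` lcs n.
Proof.
apply: lcs_ind => [|x y nx]; first exact: lcs_subgroup.
by rewrite commgEl; apply: lcsM; [apply: lcsV|apply: lcsJ].
Qed.

Lemma lcs_le m n : m <= n -> lcs n `<=` lcs m.
Proof.
elim: n => [|n IHn]; first by rewrite leqn0 => /eqP->.
by rewrite leq_eqVlt => /predU1P[->//|/IHn nm x /lcsS/nm].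
Qed.

#[global] Instance lcs_eq_equivalence n : Equivalence (lcs_eq n).
Proof.
rewrite /lcs_eq; split=> [x|x y|x y z xy yz].
- by rewrite mulVg; apply: lcs1.
- by move/lcsV; rewrite invgM invgK.
- by rewrite -[z](mulVKg y) mulgA; apply: lcsM.
Qed.

#[global] Instance lcs_eq_mul n :
  Proper (lcs_eq n ==> lcs_eq n ==> lcs_eq n) (@mul T).
Proof.
rewrite /lcs_eq => x x' xx' y y' yy'.
suff -> : (x * y)^-1 * (x' * y') = (x^-1 * x') ^ y * (y^-1 * y').
  by apply: lcsM => //; apply: lcsJ.
by rewrite conjgE !gnorm.
Qed.

#[global] Instance lcs_eq_inv n : Proper (lcs_eq n ==> lcs_eq n) (@monoid.inv T).
Proof.
rewrite /lcs_eq => x x' /lcsV/(@lcsJ _ _ x^-1).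
by rewrite conjgE !gnorm.
Qed.

#[global] Instance lcs_eq_natexp n :
  Proper (lcs_eq n ==> eq ==> lcs_eq n) (@natexp T).
Proof.
move=> x x' xx' k _ <-; elim: k => [|k IHk]; first reflexivity.
by rewrite !expgS IHk xx'; reflexivity.
Qed.

#[global] Instance lcs_proper n : Proper (lcs_eq n ==> iff) (lcs n).
Proof.
have dir x y : lcs_eq n x y -> lcs n x -> lcs n y.
  by move=> xy nx; rewrite -[y](mulVKg x); apply: lcsM.
by move=> x y xy; split; apply: dir => //; symmetry.
Qed.

Lemma lcs_eq1 n x : lcs_eq n 1 x <-> lcs n x.
Proof. by rewrite /lcs_eq invg1 mul1g. Qed.

Lemma lcs_eqC n x y : lcs n x -> lcs_eq n.+1 (x * y) (y * x).
Proof.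
move=> nx; rewrite /lcs_eq.
suff -> : (x * y)^-1 * (y * x) = [~ x, y]^-1 by apply: lcsV; apply: lcsR.
by rewrite commgEl conjgE !gnorm.
Qed.

(** [x] is central modulo [lcs n.+1], so its powers move past [y]. *)
Lemma lcs_eqXM n x y k :
  lcs n x -> lcs_eq n.+1 ((x * y) ^+ k) (x ^+ k * y ^+ k).
Proof.
move=> nx; elim: k => [|k IHk]; first by rewrite !expg0 mulg1; reflexivity.
rewrite !expgS IHk -!mulgA (mulgA y) (mulgA _ y).
by rewrite (lcs_eqC y (lcsX k nx)); reflexivity.
Qed.

(** Conjugation by [a'] changes [[~ a, b]] only by a commutator in [lcs n.+2]. *)
Lemma lcs_eqRMl n a a' b :
  lcs n a -> lcs_eq n.+2 [~ a * a', b] ([~ a, b] * [~ a', b]).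
Proof.
move=> na.
have -> : [~ a * a', b] = [~ a, b] ^ a' * [~ a', b].
  by rewrite !commgEl !conjgE !gnorm.
have -> : [~ a, b] ^ a' = [~ a, b] * [~ [~ a, b], a'].
  by rewrite [in RHS]commgEl mulVKg.
have /lcs_eq1 <- : lcs n.+2 [~ [~ a, b], a'] by do 2!apply: lcsR.
by rewrite mulg1; reflexivity.
Qed.

Lemma lcs_eqRMr n a b b' :
  lcs n a -> lcs_eq n.+2 [~ a, b * b'] ([~ a, b] * [~ a, b']).
Proof.
move=> na.
have -> : [~ a, b * b'] = [~ a, b'] * [~ a, b] ^ b'.
  by rewrite !commgEl !conjgE !gnorm.
have -> : [~ a, b] ^ b' = [~ a, b] * [~ [~ a, b], b'].
  by rewrite [in RHS]commgEl mulVKg.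
have /lcs_eq1 <- : lcs n.+2 [~ [~ a, b], b'] by do 2!apply: lcsR.
by rewrite mulg1; apply: lcs_eqC; apply: lcsR.
Qed.

Lemma lcs_eqRXl n a b k : lcs n a -> lcs_eq n.+2 [~ a ^+ k, b] ([~ a, b] ^+ k).
Proof.
move=> na; elim: k => [|k IHk]; first by rewrite !expg0 comm1g; reflexivity.
by rewrite !expgS (lcs_eqRMl _ _ na) IHk; reflexivity.
Qed.

Lemma lcs_eqRXr n a b k : lcs n a -> lcs_eq n.+2 [~ a, b ^+ k] ([~ a, b] ^+ k).
Proof.
move=> na; elim: k => [|k IHk]; first by rewrite !expg0 commg1; reflexivity.
by rewrite !expgS (lcs_eqRMr _ _ na) IHk; reflexivity.
Qed.

(* Modulo lcs n.+2, b |-> [~ a, b] is a morphism into a commutative quotient. *)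
Lemma lcsR1 n a b : lcs n a -> lcs 1 b -> lcs n.+2 [~ a, b].
Proof.
move=> na; move: b; apply: lcs_ind => [|x y _].
  split=> [|x y nx ny|x nx]; first by rewrite /= commg1; apply: lcs1.
    by rewrite /= (lcs_eqRMr _ _ na); apply: lcsM.
  have := lcs_eqRMr x x^-1 na; rewrite mulgV commg1 lcs_eq1.
  move/(lcsM (lcsV nx)); by rewrite mulKg.
(* As [x * y = y * x * [~ x, y]], expanding [[~ a, x * y]] in both forms and cancelling leaves [[~
   a, [~ x, y]]] trivial. *)
have := lcs_eqRMr (y * x) [~ x, y] na.
rewrite -commgC !(lcs_eqRMr _ _ na).
rewrite (lcs_eqC [~ a, y] (lcsR x na)).
by rewrite /lcs_eq mulKg.
Qed.

Lemma lcs_eqR n a a' b b' : lcs n a -> lcs_eq n.+1 a a' -> lcs_eq 1 b b' ->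
  lcs_eq n.+2 [~ a, b] [~ a', b'].
Proof.
move=> na aa' bb'.
rewrite -[a'](mulVKg a) -[b'](mulVKg b) (lcs_eqRMl _ _ na).
rewrite (lcs_eqRMr _ _ na).
have /lcs_eq1 <- := lcsR1 na bb'.
have /lcs_eq1 <- := lcsR (b * (b^-1 * b')) aa'.
by rewrite !mulg1; reflexivity.
Qed.

(** Commutators are bilinear from [lcs n] modulo [lcs n.+1] and the group modulo [lcs 1], which
    carries power relations from one factor of the series to the next. *)
Lemma lcs_eqRX n a a' b b' k l : lcs n a ->
    lcs_eq n.+1 (a ^+ k) a' -> lcs_eq 1 (b ^+ l) b' ->
  lcs_eq n.+2 ([~ a, b] ^+ (k * l)) [~ a', b'].
Proof.
move=> na aa' bb'; rewrite -(lcs_eqR (lcsX k na) aa' bb').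
rewrite (lcs_eqRXr _ _ (lcsX k na)) (lcs_eqRXl _ _ na).
by rewrite expgnA; reflexivity.
Qed.
End Congruence.

(** * Morphisms, subgroups and nilpotency *)

Section Morphisms.
Variables (G H : groupType) (f : G -> H) (f_morph : monoid_morphism f).

Lemma morph1 : f 1 = 1. Proof. by case: f_morph. Qed.
Lemma morphM x y : f (x * y) = f x * f y. Proof. by case: f_morph. Qed.
Lemma morphV x : f x^-1 = (f x)^-1.
Proof. by apply: (mulgI (f x)); rewrite -morphM !mulgV morph1. Qed.
Lemma morphX x k : f (x ^+ k) = f x ^+ k.
Proof.
by elim: k => [|k IHk]; [rewrite !expg0 morph1|rewrite !expgS morphM IHk].
Qed.
Lemma morphR x y : f [~ x, y] = [~ f x, f y].
Proof. by rewrite !commgEl !conjgE !(morphM, morphV). Qed.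

Lemma morph_eval X (v : X -> G) w : f (eval v w) = eval (f \o v) w.
Proof.
elim: w => [x||w1 IH1 w2 IH2|w IHw] //=; first exact: morph1.
  by rewrite morphM IH1 IH2.
by rewrite morphV IHw.
Qed.

Lemma morph_preimage_subgroup (A : set H) :
  is_subgroup A -> is_subgroup (f @^-1` A).
Proof.
move=> [A1 AM AV]; split=> [|x y|x]; rewrite /preimage /= ?morph1 //.
  by rewrite morphM; apply: AM.
by rewrite morphV; apply: AV.
Qed.

Lemma morph_image_subgroup (A : set G) : is_subgroup A -> is_subgroup (f @` A).
Proof.
move=> [A1 AM AV]; split.
- by exists 1; rewrite ?morph1.
- move=> _ _ [x Ax <-] [y Ay <-].
  by exists (x * y); [apply: AM|rewrite morphM].
- by move=> _ [x Ax <-]; exists x^-1; [apply: AV|rewrite morphV].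
Qed.

Lemma morph_lcs n x : lcs n x -> lcs n (f x).
Proof.
move: x; elim: n => [//|n IHn]; apply: lcs_ind.
  exact/morph_preimage_subgroup/lcs_subgroup.
by move=> x y /IHn fx; rewrite /preimage /= morphR; apply: lcsR.
Qed.

Lemma inj_morph_nilpotent :
  injective f -> is_nilpotent [set: H] -> is_nilpotent [set: G].
Proof.
move=> f_inj [n H_nil]; exists n => x /morph_lcs /H_nil /= fx1.
by apply: f_inj; rewrite morph1.
Qed.
End Morphisms.

Lemma comp_morph (G H K : groupType) (g : H -> K) (f : G -> H) :
  monoid_morphism g -> monoid_morphism f -> monoid_morphism (g \o f).
Proof.
move=> g_morph f_morph; split=> [|x y] /=.
  by rewrite (morph1 f_morph) (morph1 g_morph).
by rewrite (morphM f_morph) (morphM g_morph).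
Qed.

Lemma subgroup_setT (G : groupType) : is_subgroup [set: G].
Proof. by split. Qed.

Lemma subgroup_set1 (G : groupType) : is_subgroup [set 1 : G].
Proof.
by split=> [//|x y /= -> ->|x /= ->]; rewrite ?mulg1 ?invg1.
Qed.

Lemma subgroupX (G : groupType) (A : set G) x k :
  is_subgroup A -> A x -> A (x ^+ k).
Proof.
move=> [A1 AM _] Ax; elim: k => [//|k IHk].
by rewrite expgS; apply: AM.
Qed.

Lemma val_morph (G : groupType) (A : set G) (A_subgroup : is_subgroup A) :
  monoid_morphism (val : subgroup_type A_subgroup -> G).
Proof. by split=> [|x y]; rewrite ?val1 ?valM. Qed.

Lemma lower_central_le (G : groupType) (A : set G) n :
  lower_central A n `<=` lcs n.
Proof.
elim: n => [//|n IHn]; apply: smallest_sub => [|z]; first exact: lcs_subgroup.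
by move=> [x [y [nx _ ->]]]; apply: lcsR; apply: IHn.
Qed.

Lemma nilpotent_pair (G H : groupType) : is_nilpotent [set: G] ->
  is_nilpotent [set: H] -> is_nilpotent [set: (G * H)%type].
Proof.
move=> [m G_nil] [n H_nil]; exists (maxn m n) => -[x y] xy.
have [x1 y1] : x = 1 /\ y = 1; last by rewrite x1 y1.
split.
  apply/G_nil/(lcs_le (leq_maxl m n)).
  exact: (@morph_lcs _ _ (fun z : G * H => z.1) _ _ (x, y)).
apply/H_nil/(lcs_le (leq_maxr m n)).
exact: (@morph_lcs _ _ (fun z : G * H => z.2) _ _ (x, y)).
Qed.

(** * Endomorphisms that are [k]-th powers modulo commutators *)

Section PowerEndomorphism.
Variables (G : groupType) (phi : G -> G) (k : nat).
Hypothesis phi_morph : monoid_morphism phi.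
Hypothesis phi_eqX : forall x, lcs_eq 1 (x ^+ k) (phi x).

(** By bilinearity, exponent [k ^ n.+1] on [x] and exponent [k] on [y] multiply to [k ^ n.+2] on
    [[~ x, y]]. *)
Lemma lcs_eq_power n x :
  lcs n x -> lcs_eq n.+1 (x ^+ (k ^ n.+1)%N) (phi x).
Proof.
elim: n x => [|n IHn] x nx; first by rewrite expn1.
(* Membership in [lcs n.+1] is kept in [P] so that powers distribute over products. *)
pose P := [set x | lcs n.+1 x /\ lcs_eq n.+2 (x ^+ (k ^ n.+2)%N) (phi x)].
suff /(_ _ nx) [] : lcs n.+1 `<=` P by [].
apply: lcs_ind => [|{nx}x y nx]; last first.
  split; first exact: lcsR.
  rewrite (morphR phi_morph) expnSr; exact: lcs_eqRX (IHn _ _) _.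
split=> [|{nx}x y [nx phix] [ny phiy]|{nx}x [nx phix]].
- split; first exact: lcs1.
  by rewrite expg1n (morph1 phi_morph); reflexivity.
- split; first exact: lcsM.
  rewrite (morphM phi_morph) (lcs_eqXM _ _ nx) phix phiy; reflexivity.
- split; first exact: lcsV.
  by rewrite (morphV phi_morph) expVgn phix; reflexivity.
Qed.

(** If [x ^+ l] lies in [lcs n], its power of exponent [k ^ n.+1] is congruent to [phi (x ^+ l) = 1]
    modulo [lcs n.+1]. Descending the series, some pi-number power of [x] becomes trivial. *)
Lemma power_morph_inj (pi : nat_pred) : pi.-nat k ->
  is_nilpotent [set: G] -> pi_torsion_free pi [set: G] ->
  forall x, phi x = 1 -> x = 1.
Proof.
move=> pi_k [c G_nil] G_tf x phix.
have [l pi_l /G_nil /=] : exists2 l, pi.-nat l & lcs c (x ^+ l); last exact: G_tf.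
elim: c {G_nil} => [|n [l pi_l nxl]]; first by exists 1%N.
exists (l * k ^ n.+1)%N; first by rewrite pnatM pi_l pnatX pi_k.
have := lcs_eq_power nxl.
rewrite -expgnA (morphX phi_morph) phix expg1n => E.
by apply/lcs_eq1; symmetry.
Qed.

Lemma iter_morph n : monoid_morphism (iter n phi).
Proof. by elim: n => [//|n IHn]; apply: (comp_morph phi_morph). Qed.

Lemma iter_inj n : (forall x, phi x = 1 -> x = 1) ->
  forall x, iter n phi x = 1 -> x = 1.
Proof. by move=> phi1; elim: n => [//|n IHn] x /phi1 /IHn. Qed.

(* If phi^n u = y^k z with z in lcs n, central modulo lcs n.+1, then phi z is
   congruent to the k-th power of z^(k^n). *)
Lemma iter_root n u : exists y, lcs_eq n (y ^+ k) (iter n phi u).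
Proof.
elim: n => [|n [y yu]]; first by exists 1.
pose z := (y ^+ k)^-1 * iter n phi u.
exists (z ^+ (k ^ n)%N * phi y).
rewrite (lcs_eqXM _ _ (lcsX _ yu)) -expgnA -expnSr (lcs_eq_power yu).
rewrite -(morphX phi_morph) (lcs_eqC _ (morph_lcs phi_morph yu)).
by rewrite -(morphM phi_morph) mulVKg; reflexivity.
Qed.

(** Where [lcs c] is trivial, the congruence of [iter_root] is an equality; this [c] is the same for
    all [u]. *)
Lemma iter_is_power : is_nilpotent [set: G] ->
  exists c, forall u, exists y, y ^+ k = iter c phi u.
Proof.
move=> [c G_nil]; exists c => u; have [y /G_nil /= yu] := iter_root c u.
by exists y; rewrite -[RHS](mulVKg (y ^+ k)) yu mulg1.
Qed.
End PowerEndomorphism.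

(** * Roots of a subgroup in a nilpotent group and in the completion *)

Definition pi_roots (pi : nat_pred) (G : groupType) (A : set G) : set G :=
  [set x | exists2 k, pi.-nat k & A (x ^+ k)].

Section Roots.
Variables (pi : nat_pred) (G : groupType) (A : set G).
Hypothesis A_subgroup : is_subgroup A.

(** A graded form of [pi_roots]: in the abelian factor of [lcs n] by [lcs n.+1], closure under
    products is immediate. *)
Definition lcs_roots n : set G := [set x | lcs n x /\
  exists k h, [/\ pi.-nat k, A h, lcs n h & lcs_eq n.+1 (x ^+ k) h]].

Lemma lcs_roots_subgroup n : is_subgroup (lcs_roots n).
Proof.
have [A1 AM AV] := A_subgroup.
split=> [|x y [nx [k [h [pi_k Ah nh xh]]]] [ny [l [h' [pi_l Ah' nh' yh']]]]|].
- split; first exact: lcs1.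
  by exists 1%N, 1; split=> //; [apply: lcs1|rewrite expg1; reflexivity].
- split; first exact: lcsM.
  (* Modulo [lcs n.+1], the power of [x * y] splits into that of [x], giving [h ^+ l], and that of
     [y], giving [h' ^+ k]. *)
  exists (k * l)%N, (h ^+ l * h' ^+ k); split.
  + by rewrite pnatM pi_k.
  + by apply: AM; apply: subgroupX.
  + by apply: lcsM; apply: lcsX.
  + rewrite (lcs_eqXM _ _ nx) expgnA xh mulnC expgnA yh'; reflexivity.
- move=> x [nx [k [h [pi_k Ah nh xh]]]]; split; first exact: lcsV.
  exists k, h^-1; split=> //; [exact: AV|exact: lcsV|].
  by rewrite expVgn xh; reflexivity.
Qed.

Hypothesis roots_gen : generated (pi_roots pi A) = [set: G].

(** Level 0 is [roots_gen]. Above it, roots [x] of [h] and [y] of [h'] make [[~ x, y]] a root of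
    [[~ h, h']], by bilinearity. *)
Lemma lcs_rootsE n : lcs n `<=` lcs_roots n.
Proof.
have [A1 AM AV] := A_subgroup.
elim: n => [|n IHn].
  rewrite /lcs /= -roots_gen; apply: smallest_sub => [|x [k pi_k Axk]].
    exact: lcs_roots_subgroup.
  by split=> //; exists k, (x ^+ k); split=> //; reflexivity.
apply: lcs_ind => [|x y nx]; first exact: lcs_roots_subgroup.
split; first exact: lcsR.
have [_ [k [h [pi_k Ah nh xh]]]] := IHn _ nx.
have [_ [l [h' [pi_l Ah' _ yh']]]] : lcs_roots 0 y.
  suff: [set: G] `<=` lcs_roots 0 by apply.
  rewrite -roots_gen; apply: smallest_sub => [|z [m pi_m Azm]].
    exact: lcs_roots_subgroup.
  by split=> //; exists m, (z ^+ m); split=> //; reflexivity.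
exists (k * l)%N, [~ h, h']; split; last exact: lcs_eqRX.
- by rewrite pnatM pi_k.
- by rewrite commgEl conjgE; apply: AM (AV _ Ah) (AM _ _ (AV _ Ah') (AM _ _ Ah Ah')).
- exact: lcsR.
Qed.

(** Successive approximation: the error [h^-1 * x ^+ k] lies in [lcs n], is central modulo
    [lcs n.+1], and has a power congruent to some [h'] in [A], which corrects [h ^+ l]. *)
Lemma root_mod_lcs n x :
  exists k h, [/\ pi.-nat k, A h & lcs_eq n h (x ^+ k)].
Proof.
have [A1 AM AV] := A_subgroup.
elim: n => [|n [k [h [pi_k Ah xh]]]]; first by exists 1%N, 1.
have [_ [l [h' [pi_l Ah' nh' zh']]]] := lcs_rootsE xh.
exists (k * l)%N, (h' * h ^+ l); split.
- by rewrite pnatM pi_k.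
- by apply: AM => //; apply: subgroupX.
- rewrite expgnA -[x ^+ k](mulVKg h) -(lcs_eqC h xh) (lcs_eqXM _ _ xh) -zh'.
  reflexivity.
Qed.

Lemma nilpotent_all_roots : is_nilpotent [set: G] -> pi_roots pi A = [set: G].
Proof.
move=> [c G_nil]; apply/seteqP; split=> // x _.
have [k [h [pi_k Ah /G_nil /= hx]]] := root_mod_lcs c x.
by exists k => //; rewrite -(mulVKg h (x ^+ k)) hx mulg1.
Qed.
End Roots.

(** In the subgroup [L] generated by the roots, taken as a group, the roots generate, so
    [nilpotent_all_roots] makes every element of [L] a root. *)
Lemma pi_roots_subgroup (pi : nat_pred) (G : groupType) (A : set G) :
  is_nilpotent [set: G] -> is_subgroup A -> is_subgroup (pi_roots pi A).
Proof.
move=> G_nil A_subgroup.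
pose L := generated (pi_roots pi A).
have L_subgroup : is_subgroup L by apply: generated_subgroup.
pose LT : groupType := subgroup_type L_subgroup.
pose f : LT -> G := val.
have f_morph : monoid_morphism f by apply: val_morph.
have f_inj : injective f by apply: val_inj.
pose A' := f @^-1` A.
have A'_subgroup : is_subgroup A' by apply: morph_preimage_subgroup.
suff LE : L = pi_roots pi A by rewrite -LE.
apply/seteqP; split; last exact: sub_gen_smallest.
have roots_gen : generated (pi_roots pi A') = [set: LT].
  apply/seteqP; split=> // x _.
  (* The image is a subgroup of [G] containing every root, hence all of [L]. *)
  have : L `<=` f @` generated (pi_roots pi A').
    apply: smallest_sub => [|y rAy].
      by apply: morph_image_subgroup => //; apply: generated_subgroup.
    have Ly : y \in L by rewrite inE; apply: sub_gen_smallest.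
    exists (Sub y Ly : LT) => //; apply: sub_gen_smallest.
    have [k pi_k Ayk] := rAy; exists k => //.
    by rewrite /A' /preimage /= (morphX f_morph).
  have Lx : L (f x) by have := valP x; rewrite inE.
  by move=> /(_ _ Lx) [y gy /f_inj <-].
have LT_nil : is_nilpotent [set: LT] by apply: (inj_morph_nilpotent f_morph).
have rootsT := nilpotent_all_roots A'_subgroup roots_gen LT_nil.
move=> y Ly; have Ly' : y \in L by rewrite inE.
have [k pi_k Ayk] : pi_roots pi A' (Sub y Ly' : LT) by rewrite rootsT.
by exists k => //; move: Ayk; rewrite /A' /preimage /= (morphX f_morph).
Qed.

(** By minimality it is enough that the roots of the image form a pi-complete nilpotent subgroup;
    divisibility holds because a root of a root is a root. *)
Lemma pi_completion_roots (pi : nat_pred) (G H : groupType) (iota : G -> H) :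
  is_pi_completion pi iota -> forall x, exists2 k, pi.-nat k & range iota (x ^+ k).
Proof.
move=> [iota_morph iota_inj [H_div H_tf] H_nil H_min].
suff E : pi_roots pi (range iota) = [set: H].
  by move=> x; suff: pi_roots pi (range iota) x by []; rewrite E.
have range_subgroup : is_subgroup (range iota).
  by apply: morph_image_subgroup => //; apply: subgroup_setT.
apply: H_min.
- exact: pi_roots_subgroup.
- split=> [n a pi_n [k pi_k ak]|n x pi_n _]; last exact: H_tf.
  have [x _ xn] := H_div n a pi_n I; exists x => //.
  by exists (n * k)%N; rewrite ?pnatM ?pi_n // expgnA xn.
- have [c Hc] := H_nil; exists c; apply: subset_trans Hc.
  exact: lower_central_le.
- by move=> x xr; exists 1%N.
Qed.

(** * Power endomorphisms of relatively free groups *)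

Lemma free_subgroup_eq (F : groupType) (X : Type) (b : X -> F) (A : set F) :
  is_basis b -> is_subgroup A -> (forall x, A (b x)) -> A = [set: F].
Proof.
move=> b_basis A_subgroup Ab; apply/seteqP; split=> // y _.
pose AT : groupType := subgroup_type A_subgroup.
have Ab' x : b x \in A by rewrite inE.
have [h [[h_morph hb] _]] := b_basis AT (fun x => Sub (b x) (Ab' x)).
(* The identity and the extension through [AT] both fix the basis, so uniqueness identifies them. *)
have [g [_ g_uniq]] := b_basis F b.
have g1 : g = id by apply: g_uniq; split.
have gh : g = (val : AT -> F) \o h.
  apply: g_uniq; split=> [|x]; last by rewrite /= hb SubK.
  by apply: comp_morph => //; apply: val_morph.
have -> : y = val (h y) by rewrite -[LHS]/(id y) -g1 gh.
by have := valP (h y); rewrite inE.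
Qed.

(** The endomorphism [t] of [F] raising basis elements to the [k]-th power preserves the verbal
    kernel of [p], hence descends to [G]. *)
Lemma relatively_free_power_morph (G : groupType) (k : nat) :
  relatively_free G -> exists phi : G -> G,
    monoid_morphism phi /\ forall x, lcs_eq 1 (x ^+ k) (phi x).
Proof.
move=> [F [p [[X [b b_basis]] p_morph p_surj [W p_ker]]]].
have [t [[t_morph tb] _]] := b_basis F (fun x => b x ^+ k).
have pt_morph := comp_morph p_morph t_morph.
have pt_ker x : p x = 1 -> p (t x) = 1.
  move=> px1; have : (p @^-1` [set 1]) x by [].
  rewrite p_ker; move: x {px1}.
  apply: (smallest_sub (X := (p \o t) @^-1` [set 1])) => [|_ [w [v [Ww ->]]]].
    exact: morph_preimage_subgroup (subgroup_set1 _).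
  rewrite /preimage /= (morph_eval t_morph).
  suff: (p @^-1` [set 1]) (eval (t \o v) w) by [].
  by rewrite p_ker; apply: sub_gen_smallest; exists w, (t \o v).
have pt_eq x y : p x = p y -> p (t x) = p (t y).
  move=> pxy; apply/eqP; rewrite -divg_eq1; apply/eqP.
  rewrite -(morphV pt_morph) -(morphM pt_morph); apply: pt_ker.
  by rewrite (morphM p_morph) (morphV p_morph) pxy mulgV.
(* The descent uses a set-theoretic section of [p]; by [pt_eq] the choice does not affect the
   result. *)
have lift x : {y | p y = x}.
  by apply: cid; have : range p x by [rewrite p_surj]; case=> y _; exists y.
pose s x := projT1 (lift x); have ps x : p (s x) = x by apply: projT2 (lift x).
exists (p \o t \o s); split; first split=> [|x y] /=.
- by apply: pt_ker; rewrite ps.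
- rewrite -(morphM pt_morph); apply: pt_eq.
  by rewrite (morphM p_morph) !ps.
move=> x; rewrite -{1}(ps x) /=; move: (s x) => y.
(* Powers distribute modulo [lcs 1], so [P] is a subgroup; it contains the basis. *)
pose P := [set y | lcs_eq 1 (p y ^+ k) (p (t y))].
suff PE : P = [set: F] by have : P y by rewrite PE.
apply: (free_subgroup_eq b_basis) => [|z]; last first.
  by rewrite /P /= tb (morphX p_morph); reflexivity.
split=> [|u v Pu Pv|u Pu]; rewrite /P /=.
- by rewrite (morph1 t_morph) (morph1 p_morph) expg1n; reflexivity.
- rewrite (morphM t_morph) !(morphM p_morph) (@lcs_eqXM _ 0) //.
  by rewrite (Pu : lcs_eq _ _ _) (Pv : lcs_eq _ _ _); reflexivity.
- rewrite (morphV t_morph) !(morphV p_morph) expVgn.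
  by rewrite (Pu : lcs_eq _ _ _); reflexivity.
Qed.

(** * Word values and transfer of quasi-identities *)

Lemma eval_pair (G H : groupType) X (v : X -> G) (v' : X -> H) w :
  eval (fun x => (v x, v' x)) w = (eval v w, eval v' w).
Proof. by elim: w => [x||w1 IH1 w2 IH2|w IHw] //=; rewrite ?IH1 ?IH2 ?IHw. Qed.

Lemma subgroup_eval (G : groupType) (A : set G) X (v : X -> G) w :
  is_subgroup A -> (forall x, A (v x)) -> A (eval v w).
Proof.
move=> [A1 AM AV] Av; elim: w => [x||w1 IH1 w2 IH2|w IHw] //=.
  exact: AM.
exact: AV.
Qed.

Lemma inj_morph_satisfies (G H : groupType) (f : G -> H) q :
  monoid_morphism f -> injective f -> satisfies H q -> satisfies G q.
Proof.
move=> f_morph f_inj Hq v v1; apply: f_inj.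
rewrite (morph1 f_morph) (morph_eval f_morph); apply: Hq => i.
by rewrite -(morph_eval f_morph) v1 (morph1 f_morph).
Qed.

Lemma common_root (pi : nat_pred) (G H : groupType) (iota : G -> H) n
    (v : 'I_n -> H) : monoid_morphism iota ->
  (forall x, exists2 k, pi.-nat k & range iota (x ^+ k)) ->
  exists2 k, pi.-nat k & forall i, range iota (v i ^+ k).
Proof.
move=> iota_morph roots.
have /choice [k kP] : forall i, exists k, pi.-nat k /\ range iota (v i ^+ k).
  by move=> i; have [k pi_k ?] := roots (v i); exists k.
exists (\prod_i k i)%N => [|i].
  elim/big_ind: _ => [//|a b pi_a pi_b|i _]; first by rewrite pnatM pi_a.
  by case: (kP i).
rewrite (bigD1 i) //= expgnA.
apply: (@subgroupX _ (range iota)); last by case: (kP i).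
exact: morph_image_subgroup (subgroup_setT _).
Qed.

Theorem corollary3p17 (pi : nat_pred)
    (pi_prime : forall p, p \in pi -> prime p) (pi_neq0 : exists p, p \in pi)
    (G : groupType) (G_free : relatively_free G)
    (G_nil : is_nilpotent [set: G]) (G_tf : pi_torsion_free pi [set: G])
    (Gh : groupType) (iota : G -> Gh)
    (Gh_completion : is_pi_completion pi iota) :
  same_quasivariety G Gh.
Proof.
have [iota_morph iota_inj [_ Gh_tf] Gh_nil _] := Gh_completion.
move=> q; split; last exact: inj_morph_satisfies iota_inj.
move=> Gq v v_prem.
have [k pi_k vk] := common_root v iota_morph (pi_completion_roots Gh_completion).
have /choice [u uP] : forall i, exists u, iota u = v i ^+ k.
  by move=> i; have [u _ ?] := vk i; exists u.
have [phi [phi_morph phi_eqX]] := relatively_free_power_morph k G_free.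
have [c powers] := iter_is_power phi_morph phi_eqX G_nil.
have /choice [y yP] := fun i => powers (u i).
pose psi := iter c phi.
have psi_morph : monoid_morphism psi by apply: iter_morph.
have psi1 x : psi x = 1 -> x = 1.
  have phi1 := power_morph_inj phi_morph phi_eqX pi_k G_nil G_tf.
  exact: iter_inj phi1 x.
pose graph := range (fun x => (iota x, psi x)).
have graph_subgroup : is_subgroup graph.
  apply: morph_image_subgroup (subgroup_setT _).
  split=> [|a b]; first by rewrite (morph1 iota_morph) (morph1 psi_morph).
  by rewrite (morphM iota_morph) (morphM psi_morph).
pose R := pi_roots pi graph.
have R_subgroup : is_subgroup R.
  by apply: pi_roots_subgroup => //; apply: nilpotent_pair.
have pairX (a : Gh) (b : G) n : (a, b) ^+ n = (a ^+ n, b ^+ n).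
  by elim: n => [//|n IHn]; rewrite !expgS IHn.
(* The [k]-th power of [(v i, y i)] is [(iota (u i), psi (u i))], a point of the graph. *)
have R_vy w : R (eval v w, eval y w).
  rewrite -eval_pair; apply: subgroup_eval => // i; exists k => //.
  by exists (u i) => //; rewrite pairX yP uP.
have y_prem i : eval y (qi_premise i) = 1.
  have [n pi_n [x _]] := R_vy (qi_premise i).
  (* The first coordinate gives [iota x = 1], so [x = 1], and the second makes the [n]-th power of
     the value at [y] trivial. *)
  rewrite pairX v_prem expg1n => -[/esym x1 /esym yx].
  apply: (G_tf n) => //; rewrite yx (iota_inj x 1) ?(morph1 psi_morph) //.
  by rewrite (morph1 iota_morph).
(* The same argument with the coordinates exchanged, injectivity of [psi] replacing that of
   [iota]. *)
have [n pi_n [x _]] := R_vy (qi_conclusion q).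
rewrite pairX (Gq y y_prem) expg1n => -[vx /psi1 x1].
by apply: (Gh_tf n) => //; rewrite -vx x1 (morph1 iota_morph).
Qed.
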